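(* The split square $\mathbb{Q}$ is a non-metrizable, zero-dimensional, compact, separable Hausdorff space.
   Context: The split square is the set $$\mathbb{Q} = \big([0,1)\times(0,1]\times\{1\}\big)\cup\big((0,1]\times(0,1]\times\{2\}\big)\cup\big((0,1]\times[0,1)\times\{3\}\big)\cup\big([0,1)\times[0,1)\times\{4\}\big)$$ (here $\mathbb{Q}$ does not denote the rationals), endowed with the topology generated by the basis consisting of the sets $$Q(a,b;c,d) := \big([a,b)\times(c,d]\times\{1\}\big)\cup\big((a,b]\times(c,d]\times\{2\}\big)\cup\big((a,b]\times[c,d)\times\{3\}\big)\cup\big([a,b)\times[c,d)\times\{4\}\big),$$ for $0\le a<b\le 1$, $0\le c<d\le 1$. Zero-dimensional means having a basis of clopen sets. *)

(* Defs.v *)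
From HB Require Import structures.
From mathcomp Require Import all_boot all_order all_algebra.
From mathcomp Require Import mathcomp_extra boolp classical_sets functions.
From mathcomp Require Import cardinality set_interval reals topology.

Set Implicit Arguments.
Unset Strict Implicit.
Unset Printing Implicit Defensive.

Import Order.TTheory GRing.Theory Num.Theory.

Local Open Scope classical_set_scope.
Local Open Scope ring_scope.

Section SplitSquare.
Context {R : realType}.

(* Q(a,b;c,d): the point (x, y, k) is encoded as ((x, y), k). *)
Definition split_box (a b c d : R) : set (R * R * nat) :=
  `[a, b[%classic `*` `]c, d]%classic `*` [set 1%N] `|`
  `]a, b]%classic `*` `]c, d]%classic `*` [set 2%N] `|`
  `]a, b]%classic `*` `[c, d[%classic `*` [set 3%N] `|`
  `[a, b[%classic `*` `[c, d[%classic `*` [set 4%N].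

End SplitSquare.

(* The underlying set of the split square is Q(0,1;0,1).  It is wrapped in a
   record so as not to inherit the subspace topology of R * R * nat. *)
Record split_square (R : realType) := SplitSquare {
  split_pt :> R * R * nat;
  _ : split_pt \in split_box 0 1 0 1 }.

HB.instance Definition _ (R : realType) := [isSub for @split_pt R].
HB.instance Definition _ (R : realType) := [Choice of split_square R by <:].

Section SplitTopology.
Context {R : realType}.

Definition split_basis : set (set (split_square R)) :=
  [set U | exists a b c d : R,
     [/\ 0 <= a, a < b & b <= 1] /\ [/\ 0 <= c, c < d & d <= 1] /\
     U = @split_pt R @^-1` split_box a b c d].

Lemma split_boxE (a b c d : R) (p : R * R * nat) :
  split_box a b c d p <->
  [\/ [/\ a <= p.1.1 < b, c < p.1.2 <= d & p.2 = 1%N],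
      [/\ a < p.1.1 <= b, c < p.1.2 <= d & p.2 = 2%N],
      [/\ a < p.1.1 <= b, c <= p.1.2 < d & p.2 = 3%N] |
      [/\ a <= p.1.1 < b, c <= p.1.2 < d & p.2 = 4%N]].
Proof.
case: p => [[x y] k]; rewrite /split_box /= !in_itv /=; split.
  by move=> [[[[[? ?] ?]|[[? ?] ?]]|[[? ?] ?]]|[[? ?] ?]];
    [constructor 1|constructor 2|constructor 3|constructor 4].
by case=> -[? ? ?]; [left; left; left|left; left; right|left; right|right].
Qed.

Lemma split_box_bounds (a b c d : R) (p : R * R * nat) :
  split_box a b c d p -> a < b /\ c < d.
Proof.
have lelt (u v w : R) : u <= v < w -> u < w.
  by move=> /andP[]; exact: le_lt_trans.
have ltle (u v w : R) : u < v <= w -> u < w.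
  by move=> /andP[]; exact: lt_le_trans.
move=> /split_boxE[] [h1 h2 _]; split;
  first [exact: lelt h1|exact: ltle h1|exact: lelt h2|exact: ltle h2].
Qed.

Lemma split_boxI (a b c d a' b' c' d' : R) :
  split_box a b c d `&` split_box a' b' c' d' =
  split_box (Num.max a a') (Num.min b b') (Num.max c c') (Num.min d d').
Proof.
apply/seteqP; split=> p; rewrite /setI /= !split_boxE.
  rewrite !ge_max !gt_max !le_min !lt_min.
  by move=> [] [] [/andP[-> ->] /andP[-> ->] ->] [] [/andP[-> ->] /andP[-> ->] //] _;
    [constructor 1|constructor 2|constructor 3|constructor 4].
rewrite !ge_max !gt_max !le_min !lt_min.
by move=> [] [/andP[/andP[-> ->] /andP[-> ->]] /andP[/andP[-> ->] /andP[-> ->]] ->];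
  split; do ?[by constructor 1|by constructor 2|by constructor 3|by constructor 4].
Qed.

Lemma split_basis_cover : \bigcup_(U in split_basis) U = setT.
Proof.
apply/seteqP; split=> // -[p pQ] _; exists (@split_pt R @^-1` split_box 0 1 0 1).
  by exists 0, 1, 0, 1; do !split; rewrite ?lexx ?ltr01.
exact: set_mem pQ.
Qed.

Lemma split_basis_join (U V : set (split_square R)) (p : split_square R) :
  split_basis U -> split_basis V -> U p -> V p ->
  exists W, [/\ split_basis W, W p & W `<=` U `&` V].
Proof.
move=> [a [b [c [d [[a0 ab b1] [[c0 cd d1] ->]]]]]].
move=> [a' [b' [c' [d' [[a0' ab' b1'] [[c0' cd' d1'] ->]]]]]] Up Vp.
exists (@split_pt R @^-1` (split_box a b c d `&` split_box a' b' c' d')).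
split=> //; rewrite split_boxI.
have /split_box_bounds[abI cdI] : split_box (Num.max a a') (Num.min b b')
    (Num.max c c') (Num.min d d') p by rewrite -split_boxI.
exists (Num.max a a'), (Num.min b b'), (Num.max c c'), (Num.min d d').
by split; last split; try split; rewrite // ?le_max ?ge_min ?a0 ?b1 ?c0 ?d1.
Qed.

End SplitTopology.

HB.instance Definition _ (R : realType) :=
  @isBaseTopological.Build (split_square R) (set (split_square R))
    split_basis id split_basis_cover split_basis_join.

(* Not the library's zero_dimensional, which only asks that distinct points be
   separated by a clopen set. *)
Definition zero_dimensional_space (T : topologicalType) :=
  exists2 B : set (set T), basis B & B `<=` clopen.

Definition separable (T : topologicalType) :=
  exists2 D : set T, countable D & dense D.

Definition metrizable (R : realType) (T : topologicalType) :=
  exists (M : metricType R) (f : T -> M) (g : M -> T),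
    [/\ cancel f g, cancel g f, continuous f & continuous g].

(* Main.v *)
Require Import Defs.
From mathcomp Require Import all_boot all_order all_algebra.
From mathcomp Require Import boolp classical_sets reals topology.
From mathcomp Require Import cardinality.
From mathcomp Require Import ereal normedtype lebesgue_measure lra.

Set Implicit Arguments.
Unset Strict Implicit.
Unset Printing Implicit Defensive.

Import Order.TTheory GRing.Theory Num.Theory.
Import numFieldTopology.Exports.

Local Open Scope classical_set_scope.

(** Tagging each coordinate with the side from which it is approached turns the
    split square into the square of the double arrow space, and Q(a,b;c,d) into
    a product of two "arrow intervals".  The complement of an arrow interval
    [a,b] is the union of the arrow intervals [0,a] and [b,1], so basic sets are
    clopen.  An ultrafilter converges in each coordinate to a real x, and the
    side of the limit is decided by which of the two halves of the arrow cut at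
    x belongs to the ultrafilter.  If the space were metrizable, then, being
    separable, it would not contain the uncountable family of points (x+,1/2+),
    whose neighbourhoods Q(x,1;0,1) contain (x'+,1/2+) only for x <= x'. *)

(** * Intervals and ultrafilter limits in the double arrow space *)

Section Arrow.
Context {R : realType}.
Local Open Scope ring_scope.

(* The side [true] stands for x+ (approached from the right), [false] for x-. *)
Definition arrow (a b : R) (s : bool) (x : R) : bool :=
  if s then a <= x < b else a < x <= b.

Lemma arrow_split (m a b : R) (s : bool) (x : R) :
  arrow a b s x -> arrow a m s x || arrow m b s x.
Proof. by case: s => /= /andP[-> ->] /=; case: (ltgtP x m). Qed.

Lemma arrow_disjoint (a b c d : R) (s : bool) (x : R) :
  b <= c -> arrow a b s x -> ~ arrow c d s x.
Proof.
move=> bc; case: s => /= /andP[_ xb] /andP[cx _].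
  by have := lt_le_trans xb (le_trans bc cx); rewrite ltxx.
by have := le_lt_trans (le_trans xb bc) cx; rewrite ltxx.
Qed.

Lemma arrow_lt (a b : R) (s : bool) (x : R) : arrow a b s x -> a < b.
Proof. by case: s => /= /andP[]; [exact: le_lt_trans|exact: lt_le_trans]. Qed.

Lemma arrow_bounds (a b : R) (s : bool) (x : R) : arrow a b s x -> a <= x <= b.
Proof. by case: s => /= /andP[u v]; apply/andP; split=> //; exact: ltW. Qed.

Lemma arrow_oo (a b : R) (s : bool) (x : R) : a < x < b -> arrow a b s x.
Proof. by case: s => /= /andP[u v]; apply/andP; split=> //; exact: ltW. Qed.

(** Different reals are cut at their midpoint. When the reals agree, the sides differ, and cutting
    at [x] itself leaves x- on the left and x+ on the right. *)
Lemma arrow_separated (s t : bool) (x y : R) :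
  arrow 0 1 s x -> arrow 0 1 t y -> (x, s) <> (y, t) ->
  exists m, (arrow 0 m s x /\ arrow m 1 t y) \/ (arrow 0 m t y /\ arrow m 1 s x).
Proof.
have lt_sep s' t' x' y' : arrow 0 1 s' x' -> arrow 0 1 t' y' -> x' < y' ->
    arrow 0 ((x' + y') / 2) s' x' /\ arrow ((x' + y') / 2) 1 t' y'.
  by case: s'; case: t' => /= /andP[? ?] /andP[? ?] ?; split; apply/andP; split; lra.
case: (ltgtP x y) => [xy|yx|<-] hx hy xsyt.
- by exists ((x + y) / 2); left; exact: lt_sep.
- by exists ((y + x) / 2); right; exact: lt_sep.
exists x; move: s t hx hy xsyt => [] [] //= /andP[h1 h2] /andP[h3 h4] _.
  by right; rewrite h2 h3 !lexx.
by left; rewrite h1 h4 !lexx.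
Qed.

Lemma ultra_itv_cvg {T : Type} (F : set_system T) (f : T -> R) (a b : R) :
  UltraFilter F -> F (f @^-1` `[a, b]) ->
  exists2 x : R, a <= x <= b & f @ F --> x.
Proof.
move=> FU Ff; have [x [/= xab xF]] := @segment_compact R a b (f @ F) _ Ff.
exists x; first by move: xab; rewrite in_itv.
(* Otherwise the complement of the preimage of [V] is in [F], and clustering at [x] would make [V]
   meet its own complement. *)
move=> V xV; have [//|FnV] := in_ultra_setVsetC (f @^-1` V) FU.
by have [y [nVy Vy]] := xF (~` V) V FnV xV.
Qed.

Lemma ultra_arrow_cvg {T : Type} (F : set_system T) (s : T -> bool) (f : T -> R) :
  UltraFilter F -> (forall p, arrow 0 1 (s p) (f p)) ->
  exists t x, arrow 0 1 t x /\
    forall a b, arrow a b t x -> F [set p | arrow a b (s p) (f p)].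
Proof.
move=> FU sf.
have [x /andP[x0 x1] fx] : exists2 x : R, 0 <= x <= 1 & f @ F --> x.
  apply: ultra_itv_cvg; apply: filterE => p /=.
  by rewrite in_itv /= (arrow_bounds (sf p)).
have Flt b : x < b -> F [set p | f p < b].
  by move=> xb; apply: (fx [set y | y < b]); exact: lt_nbhsl.
have Fgt a : a < x -> F [set p | a < f p].
  by move=> ax; apply: (fx [set y | a < y]); exact: lt_nbhsr.
(* [U] collects the points lying at x+ or beyond. If [F] contains it the limit is x+, otherwise
   x-. *)
pose U := [set p | x < f p \/ f p = x /\ s p].
have [FU'|FU'] := in_ultra_setVsetC U FU.
  exists true, x; split.
    (* Any point of [U] forces [x < 1], so x+ does lie in the space. *)
    have [p Up] := filter_ex FU'.
    rewrite /arrow x0 /=; have := sf p; case: Up => [xp|[<- ->] /andP[]//].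
    by move=> /arrow_bounds/andP[_]; exact: lt_le_trans.
  move=> a b /andP[ax xb].
  apply: filterS (filterI FU' (Flt _ xb)) => p [Up pb] /=.
  rewrite /arrow; case: Up => [xp|[-> ->]]; last by rewrite ax.
  by case: (s p); rewrite ?pb ?(ltW pb) ?(le_lt_trans ax xp) ?(le_trans ax (ltW xp)).
have nUE p : (~` U) p -> f p < x \/ f p = x /\ ~~ s p.
  move=> nUp; case: (ltgtP (f p) x) => [|xp|fpx]; [by left| |].
    by case: nUp; left.
  by right; split=> //; apply/negP => sp; apply: nUp; right.
exists false, x; split.
  have [p /nUE Up] := filter_ex FU'.
  rewrite /arrow x1 andbT; have := sf p.
  case: Up => [xp|[<- /negPf ->] /andP[]//].
  by move=> /arrow_bounds/andP[+ _] => /le_lt_trans; apply.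
move=> a b /andP[ax xb].
apply: filterS (filterI FU' (Fgt _ ax)) => p [/nUE Up pa] /=.
rewrite /arrow; case: Up => [xp|[fpx /negPf ->]]; last by rewrite pa fpx.
by case: (s p); rewrite ?pa ?(ltW pa) ?(lt_le_trans xp xb) ?(ltW (lt_le_trans xp xb)).
Qed.

End Arrow.

(** * The split square as a product of two double arrow spaces *)

Section SplitSquarePoints.
Context {R : realType}.
Local Open Scope ring_scope.
Implicit Type p q : split_square R.

(** Copies 1 and 4 use [a,b) in the first coordinate, copies 3 and 4 use [c,d) in the second; these
    are the coordinates approached from the right. *)
Definition xside (k : nat) : bool := (k == 1%N) || (k == 4%N).
Definition yside (k : nat) : bool := (k == 3%N) || (k == 4%N).

Definition corner (s t : bool) : nat :=
  if s then (if t then 4%N else 1%N) else (if t then 3%N else 2%N).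

Definition xarrow p a b := arrow a b (xside p.2) p.1.1.
Definition yarrow p a b := arrow a b (yside p.2) p.1.2.

Lemma split_box_corner (a b c d x y : R) (s t : bool) :
  split_box a b c d (x, y, corner s t) <-> arrow a b s x /\ arrow c d t y.
Proof.
rewrite split_boxE; case: s; case: t => /=; split; try by case=> -[].
all: case=> h1 h2.
by constructor 4.
by constructor 1.
by constructor 3.
by constructor 2.
Qed.

Lemma split_squareK p : corner (xside p.2) (yside p.2) = p.2.
Proof.
case: p => -[[x y] k] /= /set_mem /split_boxE h.
by case: h => -[_ _ /= ->].
Qed.

Lemma split_boxP p (a b c d : R) :
  split_box a b c d p <-> xarrow p a b /\ yarrow p c d.
Proof.
rewrite /xarrow /yarrow -split_box_corner split_squareK.
by case: p => -[[x y] k].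
Qed.

Lemma split_square01 p : xarrow p 0 1 /\ yarrow p 0 1.
Proof. by apply/split_boxP; case: p => p /= /set_mem. Qed.

Lemma split_square_inj p q :
  (p.1.1, xside p.2) = (q.1.1, xside q.2) ->
  (p.1.2, yside p.2) = (q.1.2, yside q.2) -> p = q.
Proof.
move=> [px sx] [py sy]; apply: val_inj => /=.
have : p.2 = q.2 by rewrite -split_squareK sx sy split_squareK.
by move: px py; case: (val p) (val q) => -[x y] k [[x' y'] k'] /= -> -> ->.
Qed.

Lemma split_square_ex (s t : bool) (x y : R) :
  arrow 0 1 s x -> arrow 0 1 t y ->
  exists p : split_square R, forall a b c d,
    split_box a b c d p <-> arrow a b s x /\ arrow c d t y.
Proof.
move=> sx ty.
have h : (x, y, corner s t) \in split_box 0 1 0 1.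
  by apply/mem_set/split_box_corner.
by exists (SplitSquare h) => a b c d; exact: split_box_corner.
Qed.

Definition qbox (a b c d : R) : set (split_square R) :=
  @split_pt R @^-1` split_box a b c d.

Lemma split_basis_qbox (a b c d : R) :
  0 <= a -> a < b -> b <= 1 -> 0 <= c -> c < d -> d <= 1 ->
  split_basis (qbox a b c d).
Proof. by move=> *; exists a, b, c, d. Qed.

Lemma open_split_basis (U : set (split_square R)) : split_basis U -> open U.
Proof. by move=> BU; exists [set U] => [_ ->//|]; rewrite bigcup_set1. Qed.

(** Degenerate boxes are empty, hence open. They occur in complements of boxes that touch the
    boundary of the square. *)
Lemma open_qbox (a b c d : R) :
  0 <= a -> b <= 1 -> 0 <= c -> d <= 1 -> open (qbox a b c d).
Proof.
move=> a0 b1 c0 d1.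
have [ab|ab] := boolP ((a < b) && (c < d)).
  by case/andP: ab => ab cd; exact/open_split_basis/split_basis_qbox.
rewrite (_ : qbox a b c d = set0); first exact: open0.
apply/seteqP; split=> // p.
by move/split_box_bounds => -[ab' cd']; rewrite ab' cd' in ab.
Qed.

Lemma open_split_basisP (U : set (split_square R)) p : open U -> U p ->
  exists2 B, split_basis B & B p /\ B `<=` U.
Proof.
move=> [D sD <-] [B DB Bp]; exists B; first exact: sD.
by split=> // q Bq; exists B.
Qed.

Lemma split_basisP : basis (@split_basis R).
Proof.
split=> [U|p V]; first exact: open_split_basis.
rewrite nbhsE => -[U [Uo Up] UV].
have [B BB [Bp BU]] := open_split_basisP Uo Up.
by exists B => //; exact: subset_trans UV.
Qed.

Lemma closed_qbox (a b c d : R) :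
  0 <= a -> a < b -> b <= 1 -> 0 <= c -> c < d -> d <= 1 ->
  closed (qbox a b c d).
Proof.
move=> a0 ab b1 c0 cd d1; rewrite -openC.
(* The strips to the left, right, below and above the box; they may overlap near the corners. *)
rewrite (_ : ~` _ = qbox 0 a 0 1 `|` qbox b 1 0 1 `|`
                    (qbox 0 1 0 c `|` qbox 0 1 d 1)); last first.
  apply/seteqP; split=> p.
    have [x01 y01] := split_square01 p.
    move=> /split_boxP nabcd.
    have /orP[xa|xa1] := arrow_split a x01.
      by left; left; apply/split_boxP.
    have /orP[xab|xb] := arrow_split b xa1; last first.
      by left; right; apply/split_boxP.
    have /orP[yc|yc1] := arrow_split c y01.
      by right; left; apply/split_boxP.
    have /orP[ycd|yd] := arrow_split d yc1; last first.
      by right; right; apply/split_boxP.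
    by case: nabcd.
  move=> h /split_boxP[xab ycd]; case: h => [[]|[]] /split_boxP[h1 h2].
  - exact: arrow_disjoint (lexx a) h1 xab.
  - exact: arrow_disjoint (lexx b) xab h1.
  - exact: arrow_disjoint (lexx c) h2 ycd.
  - exact: arrow_disjoint (lexx d) ycd h2.
have a1 := ltW (lt_le_trans ab b1); have b0 := ltW (le_lt_trans a0 ab).
have c1 := ltW (lt_le_trans cd d1); have d0 := ltW (le_lt_trans c0 cd).
by apply: openU; apply: openU; apply: open_qbox.
Qed.

Lemma split_square_zero_dimensional : zero_dimensional_space (split_square R).
Proof.
exists (@split_basis R); first exact: split_basisP.
move=> U BU; split; first exact: open_split_basis.
by case: BU => a [b [c [d [[? ? ?] [[? ? ?] ->]]]]]; exact: closed_qbox.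
Qed.

Lemma split_square_compact : compact [set: split_square R].
Proof.
rewrite compact_ultra => F FU _.
have [s [x [sx Fx]]] := ultra_arrow_cvg
  FU (fun p => (split_square01 p).1).
have [t [y [ty Fy]]] := ultra_arrow_cvg
  FU (fun p => (split_square01 p).2).
have [p pE] := split_square_ex sx ty.
exists p; split=> // V; rewrite nbhsE => -[U [Uo Up] UV].
have [B [a [b [c [d [_ [_ ->]]]]]] [Bp BU]] := open_split_basisP Uo Up.
have [ax cy] := (pE a b c d).1 Bp.
apply: filterS (filterI (Fx _ _ ax) (Fy _ _ cy)) => q qabcd.
by apply/UV/BU/split_boxP.
Qed.

Lemma split_square_hausdorff : hausdorff_space (split_square R).
Proof.
move=> p q pq; have [px py] := split_square01 p; have [qx qy] := split_square01 q.
have sep U V : open U -> open V -> U p -> V q -> U `&` V !=set0.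
  by move=> Uo Vo Up Vq; apply: pq; exact: open_nbhs_nbhs.
(* Distinct points differ in a tagged coordinate; cutting the whole square there gives disjoint open
   boxes. *)
apply: split_square_inj; apply: contrapT.
  move=> /(arrow_separated px qx)[m hm].
  have /andP[/ltW m0 /ltW m1] : 0 < m < 1.
    by case: hm => -[h1 h2]; rewrite (arrow_lt h1) (arrow_lt h2).
  have o1 : open (qbox 0 m 0 1) by exact: open_qbox.
  have o2 : open (qbox m 1 0 1) by exact: open_qbox.
  case: hm => -[h1 h2].
    have [||r [/split_boxP[r1 _] /split_boxP[r2 _]]] := sep _ _ o1 o2.
    + exact/split_boxP.
    + exact/split_boxP.
    + exact: arrow_disjoint (lexx m) r1 r2.
  have [||r [/split_boxP[r1 _] /split_boxP[r2 _]]] := sep _ _ o2 o1.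
  + exact/split_boxP.
  + exact/split_boxP.
  + exact: arrow_disjoint (lexx m) r2 r1.
move=> /(arrow_separated py qy)[m hm].
have /andP[/ltW m0 /ltW m1] : 0 < m < 1.
  by case: hm => -[h1 h2]; rewrite (arrow_lt h1) (arrow_lt h2).
have o1 : open (qbox 0 1 0 m) by exact: open_qbox.
have o2 : open (qbox 0 1 m 1) by exact: open_qbox.
case: hm => -[h1 h2].
  have [||r [/split_boxP[_ r1] /split_boxP[_ r2]]] := sep _ _ o1 o2.
  + exact/split_boxP.
  + exact/split_boxP.
  + exact: arrow_disjoint (lexx m) r1 r2.
have [||r [/split_boxP[_ r1] /split_boxP[_ r2]]] := sep _ _ o2 o1.
+ exact/split_boxP.
+ exact/split_boxP.
+ exact: arrow_disjoint (lexx m) r2 r1.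
Qed.

Lemma split_square_separable : separable (split_square R).
Proof.
have [p0 _] : exists p0 : split_square R, True.
  have h : arrow 0 1 true (0 : R) by rewrite /arrow lexx ltr01.
  by have [p _] := split_square_ex h h; exists p.
(* The dense set consists of the points (x+,y+) with rational coordinates; pairs outside the square
   are sent to the default [p0]. *)
pose f (u : rat * rat) : split_square R :=
  insubd p0 (ratr u.1, ratr u.2, corner true true).
exists (range f).
  exact: card_le_trans (card_image_le f setT) (countableP _).
move=> U [p Up] Uo.
have [B [a [b [c [d [[a0 ab b1] [[c0 cd d1] ->]]]]]] [_ BU]] :=
  open_split_basisP Uo Up.
(* Rationals strictly inside the box belong to it whatever the sides. *)
have [u] := rat_in_itvoo ab; rewrite in_itv /= => uab.
have [v] := rat_in_itvoo cd; rewrite in_itv /= => vcd.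
exists (f (u, v)); split; last by exists (u, v).
have ua := arrow_oo true uab; have vc := arrow_oo true vcd.
apply: BU; rewrite /qbox /= -[split_pt _]/(val _) val_insubd ifT.
  exact/split_box_corner.
apply/mem_set/split_box_corner; case/andP: uab => u1 u2; case/andP: vcd => v1 v2.
by split; apply: arrow_oo; apply/andP; split; lra.
Qed.

End SplitSquarePoints.

(** * Non-metrizability by a counting argument *)

Section NotMetrizable.
Context {R : realType}.
Local Open Scope ring_scope.

(** A countable set has Lebesgue measure 0, while this interval has measure 1. *)
Lemma itv01_uncountable : ~ countable (`]0, 1[ : set R).
Proof.
move=> /(@countable_lebesgue_measure0 R) /eqP.
by rewrite lebesgue_measure_itv /= lte_fin ltr01 oppr0 adde0 eqe oner_eq0.
Qed.

(** Attach to [i] a radius 1/(n+1) whose ball fits in [U i], and a point [d] of [D] within half that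
    radius. If [i] and [j] share (n,d), then [p i] and [p j] are closer than 1/(n+1), so each lies
    in the neighbourhood of the other and [i = j]. Hence [A] injects into a countable set of
    pairs. *)
Lemma metrizable_countable (T : topologicalType) (I : Type) (A : set I)
    (p : I -> T) (U : I -> set T) :
  metrizable R T -> separable T ->
  (forall i, A i -> nbhs (p i) (U i)) ->
  (forall i j, A i -> A j -> U i (p j) -> U j (p i) -> i = j) ->
  countable A.
Proof.
move=> [M [f [g [fK gK fc gc]]]] [D Dc Dd] pU pinj.
have ballU i : A i -> exists n, ball (f (p i)) n.+1%:R^-1 `<=` g @^-1` U i.
  move=> Ai.
  have : nbhs (f (p i)) (g @^-1` U i).
    by apply: gc; rewrite fK; exact: pU.
  (* This [n] satisfies 1/e < n+1, so the ball of radius 1/(n+1) is inside that of radius [e]. *)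
  rewrite -nbhs_ballE => -[e /= e0 eU]; exists (Num.truncn e^-1).
  apply: subset_trans eU; apply: le_ball.
  rewrite -[leRHS]invrK lef_pV2 ?posrE ?invr_gt0//.
  exact/ltW/truncnS_gt.
have /choice[h hP] : forall i, exists nd : nat * T, A i ->
    [/\ D nd.2, ball (f (p i)) (nd.1.+1%:R^-1 / 2) (f nd.2) &
        ball (f (p i)) nd.1.+1%:R^-1 `<=` g @^-1` U i].
  move=> i; have [Ai|nAi] := pselect (A i); last by exists (0%N, p i).
  have [n nU] := ballU i Ai.
  have : nbhs (p i) (f @^-1` ball (f (p i)) (n.+1%:R^-1 / 2)).
    by apply: fc; apply: nbhsx_ballx; rewrite divr_gt0 ?invr_gt0.
  rewrite nbhsE => -[V [Vo Vp] VB].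
  have [d [/VB dB Dd']] := Dd V (ex_intro _ _ Vp) Vo.
  by exists (n, d).
have cX : countable ([set: nat] `*` D) by exact: countableX.
have hinj : {in A &, injective h}.
  move=> i j /set_mem Ai /set_mem Aj hij.
  have [_ bi Ui] := hP i Ai; have [_ bj Uj] := hP j Aj.
  rewrite -hij in bj Uj.
  have bij := ball_triangle bi (ball_sym bj).
  rewrite -splitr in bij.
  apply: pinj => //.
    by have := Ui _ bij; rewrite /preimage /= fK.
  by have := Uj _ (ball_sym bij); rewrite /preimage /= fK.
rewrite -(eq_countable (inj_card_eq hinj)).
apply: sub_countable cX; apply: subset_card_le.
by move=> _ [i /hP[Dhi _ _] <-].
Qed.

Lemma split_square_not_metrizable : ~ metrizable R (split_square R).
Proof.
move=> Mt; apply: itv01_uncountable.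
have half : arrow 0 1 true (2^-1 : R) by rewrite /arrow; apply/andP; split; lra.
(* [p x] is (x+,1/2+) for [x] in ]0,1[ and an arbitrary point elsewhere, so that [p] is total. *)
have /choice[p pP] : forall x : R, exists p : split_square R, 0 < x < 1 ->
    forall a b c d, split_box a b c d p <->
      arrow a b true x /\ arrow c d true 2^-1.
  move=> x; have [x01|nx] := pselect (0 < x < 1).
    have [p pP] := split_square_ex (arrow_oo true x01) half.
    by exists p.
  by have [p _] := split_square_ex half half; exists p.
apply: (@metrizable_countable _ _ _ p (fun x => qbox x 1 0 1) Mt
  split_square_separable).
  move=> x; rewrite /= in_itv /= => x01; case/andP: (x01) => x0 x1.
  apply: open_nbhs_nbhs; split; first by apply: open_qbox => //; exact: ltW.
  by apply/(pP x x01); split=> //; rewrite /arrow lexx.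
move=> x y; rewrite /= !in_itv /= => x01 y01.
move=> /(pP y y01)[/andP[xy _] _] /(pP x x01)[/andP[yx _] _].
by apply/eqP; rewrite eq_le xy yx.
Qed.

End NotMetrizable.

Theorem theorem2p2 (R : realType) :
  [/\ ~ metrizable R (split_square R),
      zero_dimensional_space (split_square R),
      compact [set: split_square R],
      separable (split_square R) &
      hausdorff_space (split_square R)].
Proof.
split.
- exact: split_square_not_metrizable.
- exact: split_square_zero_dimensional.
- exact: split_square_compact.
- exact: split_square_separable.
- exact: split_square_hausdorff.
Qed.
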